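(* For every constant $c\in(0,1)$ and every integer $d\ge 1$ there are constants $\kappa>0$ and $n_0$, depending only on $c$ and $d$, such that the following holds for every $n\ge n_0$ for which $t=cn$ is an integer and for every finite field $\mathbb{F}_q$. If $C:\mathbb{F}_q^{t}\to\mathbb{F}_q^{n}$ is an unrestricted arithmetic circuit of depth $d$ (allowing arbitrary gates and unbounded fan-in) whose inputs consist of the secret together with $t-1$ random elements and whose outputs are the $n$ shares of a $(t,n)$-threshold secret sharing scheme, then the number of wires in $C$ is at least $\kappa\,\lambda_d(n)\,n$. (That is, the number of wires is $\Omega_{d,c}(\lambda_d(n)\cdot n)$.)
   Context: Unrestricted arithmetic circuit over $\mathbb{F}_q$: a finite directed acyclic graph with designated input vertices (having no incoming edges) and designated output vertices; each non-input vertex (gate) of in-degree $k$ computes an arbitrary function $\mathbb{F}_q^k\to\mathbb{F}_q$ of the values of its in-neighbours; $k$ is unbounded. Wires are the edges; depth is the maximum number of edges on a directed path from an input to an output. Computing the shares of a $(t,n)$-threshold secret sharing scheme: let $S$ (the value at the secret input) be uniform over $\mathbb{F}_q$, let the values at the $t-1$ random inputs be uniform over $\mathbb{F}_q$, with all inputs mutually independent, and let $Y_1,\dots,Y_n$ be the values of the $n$ outputs (the shares). For $T\subseteq[n]$ let $Y_T=(Y_i)_{i\in T}$. It is required that $H(S\mid Y_T)=0$ for every $T\subseteq[n]$ with $|T|=t$ and $H(S\mid Y_T)=H(S)$ for every $T\subseteq[n]$ with $|T|=t-1$, where $H$ is Shannon entropy. Functions $\lambda_d$: for $f:\mathbb{N}\to\mathbb{N}$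 with $f(n)<n$ for all $n>1$, let $f^{(i)}$ be the $i$-fold composition ($f^{(1)}=f$) and $f^*(n)=\min\{i\ge1: f^{(i)}(n)\le 1\}$. Define $\lambda_1(n)=\lfloor\sqrt n\rfloor$, $\lambda_2(n)=\lceil\log_2 n\rceil$, and $\lambda_d(n)=\lambda_{d-2}^*(n)$ for $d\ge3$. *)

(* Defs.v *)
From HB Require Import structures.
From Stdlib Require PeanoNat.
From mathcomp Require Import all_boot all_order all_algebra.
From mathcomp Require Import boolp reals exp.
Set Implicit Arguments.
Unset Strict Implicit.
Unset Printing Implicit Defensive.
Import Order.TTheory GRing.Theory Num.Theory.

(** The default [0] is reached only if no iterate of [f] at [n] is at most
    [1]; by [starP] this never happens for [1 < n] when [f] is decreasing in
    the sense of its hypothesis. *)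
Definition star (f : nat -> nat) (n : nat) : nat :=
  if pselect (exists i, (0 < i) && (iter i f n <= 1)) is left h
  then ex_minn h else 0.

(** [Nat.sqrt n] is the floor of the square root, and [up_log 2 n] is the least
    [e] with [n <= 2 ^ e].  The value at index [0] is a dummy. *)
Fixpoint lambda (d : nat) : nat -> nat :=
  match d with
  | 0 => fun=> 0
  | 1 => Nat.sqrt
  | 2 => up_log 2
  | (k.+1 as e).+2 => star (lambda e)
  end.

Lemma lambdaS3 d n : lambda d.+3 n = star (lambda d.+1) n.
Proof. by []. Qed.

Lemma starP (f : nat -> nat) (n : nat) :
    (forall m, 1 < m -> f m < m) -> 1 < n ->
  [/\ 0 < star f n < n, iter (star f n) f n <= 1 &
      forall i, 0 < i -> iter i f n <= 1 -> star f n <= i].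
Proof.
move=> fP n1.
have [i /andP[i0 ilt] iP] : exists2 i, 0 < i < n & iter i f n <= 1.
  elim/ltn_ind: n n1 => n IH n1.
  have [f1|f1] := leqP (f n) 1; first by exists 1.
  have [i /andP[i0 ilt] iP] := IH _ (fP _ n1) f1.
  exists i.+1; last by rewrite iterSr.
  by rewrite /= (leq_ltn_trans ilt (fP _ n1)).
rewrite /star; case: pselect => [h|[]]; last by exists i; rewrite i0.
case: ex_minnP => m /andP[m0 mP] mmin; split=> //.
- by rewrite m0 (leq_ltn_trans (mmin i _) ilt) // i0.
- by move=> j j0 jP; apply: mmin; rewrite j0.
Qed.

Lemma lambda_lt d n : 1 < n -> lambda d n < n.
Proof.
elim/ltn_ind: d n => -[|[|[|d]]] IH n n1.
- exact: ltnW.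
- by apply/ssrnat.ltP; apply: PeanoNat.Nat.sqrt_lt_lin; apply/ssrnat.ltP.
- case: n n1 => [//|n] n1; rewrite ltnS.
  by apply: up_log_min => //; apply: ltn_expl.
- rewrite lambdaS3.
  by have [] := @starP (lambda d.+1) n (IH _ (ltnW (ltnSn _))) n1; case/andP.
Qed.

(** The function [gate v] is meant for non-input vertices only; at an input
    vertex it is ignored.  A non-input vertex of in-degree [0] is a constant. *)
Record circuit (F : Type) (m n : nat) := Circuit {
  vertex : finType;
  wire : rel vertex;
  input : 'I_m -> vertex;
  output : 'I_n -> vertex;
  gate : forall v : vertex, {ffun {u : vertex | wire u v} -> F} -> F;
  wire_acyclic : forall u v, wire u v -> ~~ connect wire v u;
  input_inj : injective input;
  output_inj : injective output;
  input_source : forall u i, ~~ wire u (input i)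
}.

Definition wires F m n (C : circuit F m n) : nat :=
  #|[set e : vertex C * vertex C | wire e.1 e.2]|.

(** Bounding the length by the number of vertices loses nothing, as directed
    paths of an acyclic graph are simple: see [leq_depth]. *)
Definition depth F m n (C : circuit F m n) : nat :=
  \max_(k < #|vertex C| |
        [exists p : k.-tuple (vertex C), [exists i : 'I_m, [exists j : 'I_n,
           path (@wire _ _ _ C) (input C i) p
           && (last (input C i) p == output C j)]]])
    (k : nat).

Lemma acyclic_uniq F m n (C : circuit F m n) (v : vertex C) p :
  path (@wire _ _ _ C) v p -> uniq (v :: p).
Proof.
elim: p v => [//|w p IH] v /= /andP[vw wp].
have := IH w wp => /= ->; rewrite andbT.
apply: contra (wire_acyclic vw) => vp.
by apply: (path_connect wp).
Qed.

Lemma leq_depth F m n (C : circuit F m n) i j p :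
    path (@wire _ _ _ C) (input C i) p ->
    last (input C i) p = output C j ->
  size p <= depth C.
Proof.
move=> pP pl.
have sp : size p < #|vertex C|.
  by have /card_uniqP/= <- := acyclic_uniq pP; apply: max_card.
apply: (@leq_bigmax_cond _ _ (fun k : 'I_#|vertex C| => k : nat)
  (Ordinal sp)) => /=.
apply/existsP; exists (in_tuple p); apply/existsP; exists i.
by apply/existsP; exists j; rewrite /= pP pl eqxx.
Qed.

(** Values at the vertices are computed by sweeping over the whole circuit
    [#|vertex C|] times, after which they are stable; [eval_input] and
    [eval_gate] are the defining equations, and [eval_unique] says that they
    determine the values. *)
Definition sweep (F : Type) m n (C : circuit F m n) (x : 'I_m -> F)
    (a : vertex C -> F) (v : vertex C) : F :=
  if [pick i | input C i == v] is Some i then x i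
  else gate [ffun u : {u | wire u v} => a (val u)].

Definition eval (F : nmodType) m n (C : circuit F m n) (x : 'I_m -> F) :
    vertex C -> F :=
  iter #|vertex C| (sweep x) (fun=> 0%R).

Lemma sweep_ext (F : Type) m n (C : circuit F m n) (x : 'I_m -> F)
    (a b : vertex C -> F) v :
  (forall u, wire u v -> a u = b u) -> sweep x a v = sweep x b v.
Proof.
move=> ab; rewrite /sweep; case: pickP => // _.
by congr gate; apply/ffunP => -[u uv]; rewrite !ffunE /= ab.
Qed.

Lemma anc_lt F m n (C : circuit F m n) (u v : vertex C) :
  wire u v ->
  #|[pred w | connect (@wire _ _ _ C) w u]|
    < #|[pred w | connect (@wire _ _ _ C) w v]|.
Proof.
move=> uv; apply: proper_card; apply/properP; split.
  apply/fintype.subsetP => w; rewrite !inE => wu.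
  exact: connect_trans wu (connect1 uv).
by exists v; rewrite !inE ?connect0 // wire_acyclic.
Qed.

Lemma evalE (F : nmodType) m n (C : circuit F m n) (x : 'I_m -> F) v :
  eval x v = sweep x (eval (C := C) x) v.
Proof.
have H k w : #|[pred u | connect (@wire _ _ _ C) u w]| <= k ->
    iter k.+1 (sweep x) (fun=> 0%R) w = iter k (sweep x) (fun=> 0%R) w.
  elim: k w => [|k IH] w.
    by rewrite leqn0 => /eqP/card0_eq/(_ w); rewrite !inE connect0.
  move=> wk; apply: sweep_ext => u uw.
  by apply: IH; rewrite -ltnS (leq_trans (anc_lt uw) wk).
by rewrite /eval -iterS H // max_card.
Qed.

Lemma eval_input (F : nmodType) m n (C : circuit F m n) (x : 'I_m -> F) i :
  eval x (input C i) = x i.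
Proof.
rewrite evalE /sweep; case: pickP => [j /eqP/input_inj -> //|/(_ i)].
by rewrite eqxx.
Qed.

Lemma eval_gate (F : nmodType) m n (C : circuit F m n) (x : 'I_m -> F) v :
  (forall i, input C i != v) ->
  eval x v = gate [ffun u : {u | wire u v} => eval x (val u)].
Proof.
by move=> vP; rewrite evalE /sweep; case: pickP => // i; rewrite (negPf (vP i)).
Qed.

Lemma eval_unique (F : nmodType) m n (C : circuit F m n) (x : 'I_m -> F)
    (a : vertex C -> F) :
    (forall i, a (input C i) = x i) ->
    (forall v, (forall i, input C i != v) ->
       a v = gate [ffun u : {u | wire u v} => a (val u)]) ->
  a =1 eval x.
Proof.
move=> ai ag v.
have [k] := ubnP #|[pred w | connect (@wire _ _ _ C) w v]|.
elim: k v => // k IH v vk.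
case: (pickP (fun i => input C i == v)) => [i /eqP <-|vP].
  by rewrite ai eval_input.
have vN i : input C i != v by rewrite vP.
rewrite ag // eval_gate //; congr gate; apply/ffunP => -[u uv].
by rewrite !ffunE /= IH // (leq_trans (anc_lt uv)).
Qed.

Local Open Scope ring_scope.

Definition log2 (R : realType) (x : R) : R := ln x / ln 2.

Definition pr (R : realType) (Om : finType) (P : Om -> R) (E : pred Om) : R :=
  \sum_(w | E w) P w.

(** The convention [0 * log2 0 = 0] is automatic below, the functions [ln] and
    division being total. *)
Definition entropy (R : realType) (Om : finType) (P : Om -> R)
    (A : finType) (X : Om -> A) : R :=
  - \sum_(a : A) (let p := pr P [pred w | X w == a] in p * log2 p).

Definition cond_entropy (R : realType) (Om : finType) (P : Om -> R)
    (A B : finType) (X : Om -> A) (Y : Om -> B) : R :=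
  \sum_(b : B) (let pb := pr P [pred w | Y w == b] in
    pb * - \sum_(a : A)
      (let p := pr P [pred w | (X w == a) && (Y w == b)] / pb in p * log2 p)).

Definition uniform_dist (R : realType) (A : finType) (a : A) : R :=
  (#|A|%:R)^-1.

(** Joint law of [m] mutually independent uniform elements of [A]. *)
Definition indep_uniform (R : realType) (A : finType) (m : nat)
    (x : {ffun 'I_m -> A}) : R :=
  \prod_(i < m) uniform_dist R (x i).

Definition shares (F : finFieldType) (t n : nat) (C : circuit F t n)
    (T : {set 'I_n}) (x : {ffun 'I_t -> F}) : {ffun {i : 'I_n | i \in T} -> F} :=
  [ffun i => eval x (output C (val i))].

(** [s] is the position of the secret among the [t] inputs; the other [t - 1]
    inputs are the random elements. *)
Definition computes_threshold_shares (R : realType) (F : finFieldType)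
    (t n : nat) (C : circuit F t n) (s : 'I_t) : Prop :=
  let P := @indep_uniform R F t in
  let S := fun x : {ffun 'I_t -> F} => x s in
  (forall T : {set 'I_n}, #|T| = t -> cond_entropy P S (shares C T) = 0) /\
  (forall T : {set 'I_n}, #|T| = t.-1 ->
     cond_entropy P S (shares C T) = entropy P S).

(* Main.v *)
(** For an ideal threshold scheme, every [t] shares are a bijective function of
    the [t] inputs: fixing [t - 1] shares leaves the secret arbitrary, so the
    next share takes all values.  Counting values then gives the connection
    property: if [A] is a set of inputs and [H] a set of vertices with
    [#|H| < #|A|], then fewer than [t] outputs are unreachable from [A] once [H]
    is deleted, since the values on [H] would otherwise determine [t] outputs.

    The number of edges of a layered network with this property is bounded below
    by induction on the depth, in steps of two.  Cut the degrees (towards the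
    inputs in the second layer, towards the outputs in the last but one) into
    ranges by thresholds [D_0 < D_1 < ...].  If some range carries few edges, then
    delete the few inputs and outputs adjacent to it, add the vertices of larger
    degree to [H], and short-cut the paths through the vertices of smaller degree
    [<= D_i].  The resulting network has depth smaller by two and at most
    [D_i ^ 2] times as many edges, which contradicts the induction hypothesis when
    [D_(i+1)] is large enough compared to [D_i].  Hence all ranges carry a linear
    number of edges, and there are about [star g] of them if [g] is the bound for
    the smaller depth. *)
Require Import Defs.
From Stdlib Require PeanoNat.
From mathcomp Require Import all_boot all_order all_algebra zify ring lra.
From mathcomp Require Import boolp reals sequences exp.
Set Implicit Arguments.
Unset Strict Implicit.
Unset Printing Implicit Defensive.
Import Order.TTheory GRing.Theory Num.Theory.

(** * Layered networks *)

Section Networks.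
Variable V : finType.
Implicit Types (R S : {set V * V}) (rs : seq {set V * V}) (A H I O P : {set V}).

(** The members of [rs] are successive layers of edges on one common vertex type, so that
    contracting two layers merely shortens the list. *)
Fixpoint conn rs H x y : bool :=
  (x \notin H) &&
  (if rs is R :: rs' then [exists z, ((x, z) \in R) && conn rs' H z y]
   else x == y).

Lemma conn_cons R rs H x y :
  reflect (exists z, [/\ x \notin H, (x, z) \in R & conn rs H z y])
          (conn (R :: rs) H x y).
Proof.
apply: (iffP andP) => [[xH /existsP[z /andP[xz zy]]]|[z [xH xz zy]]].
  by exists z.
by split=> //; apply/existsP; exists z; rewrite xz.
Qed.

Lemma conn_rcons R rs H x y :
  reflect (exists z, [/\ conn rs H x z, (z, y) \in R & y \notin H])
          (conn (rcons rs R) H x y).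
Proof.
elim: rs x => [|T rs IH] x.
  apply: (iffP (conn_cons R [::] _ _ _)).
    case=> z [xH xz /andP[zH /eqP <-]].
    by exists x; split=> //; rewrite /= xH eqxx.
  case=> z [/andP[xH /eqP xz] zy yH]; exists y.
  by rewrite xz in xH *; split=> //; rewrite /= yH eqxx.
apply: (iffP (conn_cons T (rcons rs R) _ _ _)).
  case=> w [xH xw /IH[z [wz zy yH]]]; exists z; split=> //.
  by apply/conn_cons; exists w.
case=> z [/conn_cons[w [xH xw wz]] zy yH]; exists w; split=> //.
by apply/IH; exists z.
Qed.

Lemma conn_sub rs H H' x y :
  H \subset H' -> conn rs H' x y -> conn rs H x y.
Proof.
move=> sH; have nH u : u \notin H' -> u \notin H.
  by apply: contra; apply/subsetP: u.
elim: rs x => [|R rs IH] x; first by case/andP => /nH /= -> ->.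
by case/conn_cons=> z [/nH xH xz /IH zy]; apply/conn_cons; exists z.
Qed.

Definition reach rs H A : {set V} := [set y | [exists x in A, conn rs H x y]].

Lemma reachP rs H A y :
  reflect (exists2 x, x \in A & conn rs H x y) (y \in reach rs H A).
Proof. by rewrite inE; apply: exists_inP. Qed.

(** [h] counts the vertices deleted by earlier contractions. *)
Definition robust K n h rs I O :=
  n <= K * #|I| /\
  forall A H, A \subset I -> #|H| + h < #|A| -> n <= K * #|reach rs H A :&: O|.

Definition edges rs := \sum_(R <- rs) #|R|.

Definition indeg R y := #|[set x | (x, y) \in R]|.
Definition outdeg R x := #|[set y | (x, y) \in R]|.

Lemma sum_indeg R P : \sum_(y in P) indeg R y = #|[set e in R | e.2 \in P]|.
Proof.
have -> : #|[set e in R | e.2 \in P]| =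
    \sum_(e | (e.2 \in P) && ((e.1, e.2) \in R)) 1.
  by rewrite -sum1dep_card; apply: eq_bigl => -[x y]; rewrite andbC.
rewrite -(pair_big_dep xpredT (fun x y => (y \in P) && ((x, y) \in R))
  (fun _ _ => 1)) /= (exchange_big_dep (mem P)) /=; last by move=> i j _ /andP[].
apply: eq_bigr => y yP.
by rewrite /indeg -sum1dep_card; apply: eq_bigl => x; rewrite yP.
Qed.

Lemma sum_outdeg R P : \sum_(x in P) outdeg R x = #|[set e in R | e.1 \in P]|.
Proof.
have -> : #|[set e in R | e.1 \in P]| =
    \sum_(e | (e.1 \in P) && ((e.1, e.2) \in R)) 1.
  by rewrite -sum1dep_card; apply: eq_bigl => -[x y]; rewrite andbC.
rewrite -(pair_big_dep (mem P) (fun x y => ((x, y) \in R))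
  (fun _ _ => 1)) /=.
by apply: eq_bigr => x xP; rewrite /outdeg -sum1dep_card.
Qed.

Lemma sum_indegT R : \sum_y indeg R y = #|R|.
Proof.
rewrite -[in RHS](_ : [set e in R | e.2 \in setT] = R) -?sum_indeg.
  by apply: eq_bigl => x; rewrite inE.
by apply/setP => e; rewrite !inE andbT.
Qed.

Lemma sum_outdegT R : \sum_y outdeg R y = #|R|.
Proof.
rewrite -[in RHS](_ : [set e in R | e.1 \in setT] = R) -?sum_outdeg.
  by apply: eq_bigl => x; rewrite inE.
by apply/setP => e; rewrite !inE andbT.
Qed.

Lemma card_ge_le_sum (f : V -> nat) k : k * #|[set v | k <= f v]| <= \sum_v f v.
Proof.
rewrite -sum1_card big_distrr big_mkcond /=.
by apply: leq_sum => v _; rewrite inE muln1; case: ifP.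
Qed.

Definition relcomp P R S : {set V * V} :=
  [set e | [exists y in P, ((e.1, y) \in R) && ((y, e.2) \in S)]].

Lemma relcompP P R S x z :
  reflect (exists y, [/\ y \in P, (x, y) \in R & (y, z) \in S])
          ((x, z) \in relcomp P R S).
Proof.
rewrite inE; apply: (iffP exists_inP) => [[y yP /andP[xy yz]]|[y [yP xy yz]]].
  by exists y.
by exists y; rewrite //= xy.
Qed.

Lemma card_relcomp P R S :
  #|relcomp P R S| <= \sum_(y in P) indeg R y * outdeg S y.
Proof.
have sub : relcomp P R S \subset
    \bigcup_(y in P) setX [set x | (x, y) \in R] [set z | (y, z) \in S].
  apply/subsetP => -[x z] /relcompP[y [yP xy yz]].
  by apply/bigcupP; exists y => //; rewrite !inE /= xy.
apply: leq_trans (subset_leq_card sub) _.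
apply: (big_rec2 (fun (X : {set V * V}) k => #|X| <= k)); first by rewrite cards0.
move=> y k X _ Xk; apply: leq_trans (leq_card_setU _ _).1 _.
by rewrite leq_add // cardsX.
Qed.

Lemma card_relcomp_in P R S D :
  (forall y, y \in P -> indeg R y <= D) -> #|relcomp P R S| <= D * #|S|.
Proof.
move=> le; apply: leq_trans (card_relcomp _ _ _) _.
rewrite -sum_outdegT big_distrr /= big_mkcond /=.
by apply: leq_sum => y _; case: ifP => // yP; rewrite leq_mul2r le ?orbT.
Qed.

Lemma card_relcomp_out P R S D :
  (forall y, y \in P -> outdeg S y <= D) -> #|relcomp P R S| <= D * #|R|.
Proof.
move=> le; apply: leq_trans (card_relcomp _ _ _) _.
rewrite -sum_indegT big_distrr /= big_mkcond /=.
by apply: leq_sum => y _; case: ifP => // yP; rewrite mulnC leq_mul2r le ?orbT.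
Qed.

(** An edge of [R] with head outside [P :|: H0] is disposed of by dropping its tail from [I]. At
    most [n / (2 * K)] edges are of this kind, so half of the guaranteed [n / K] inputs survive.
    Once [H0] is deleted too, every path from a surviving input has its second vertex in [P]. *)
Lemma robust_front K n h R S rs I O P H0 :
    robust K n h (R :: S :: rs) I O ->
    2 * K * #|[set e in R | e.2 \notin P :|: H0]| <= n ->
  exists I', robust (2 * K) n (h + #|H0|) (relcomp P R S :: rs) I' O.
Proof.
case=> nI rob; set M := [set e in R | _] => le.
pose B := [set e.1 | e in M]; exists (I :\: B); split.
  have BM : #|B| <= #|M| := leq_imset_card _ _.
  have IB : #|I :&: B| <= #|B| := subset_leq_card (subsetIr _ _).
  have := cardsID B I; nia.
move=> A H sA cA.
have sI : A \subset I by apply: subset_trans sA (subsetDl _ _).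
have [cH _] := leq_card_setU H H0.
have := rob A (H :|: H0) sI ltac:(lia).
suff : reach (R :: S :: rs) (H :|: H0) A :&: O \subset
       reach (relcomp P R S :: rs) H A :&: O.
  by move/subset_leq_card; nia.
apply: setSI; apply/subsetP => y /reachP[x xA].
case/conn_cons => u [xH xu /conn_cons[w [uH uw wy]]].
apply/reachP; exists x => //; apply/conn_cons; exists w; split.
- by move: xH; rewrite inE negb_or => /andP[].
- apply/relcompP; exists u; split=> //.
  apply: contraTT (subsetP sA x xA) => uP; rewrite inE negb_and negbK.
  apply/orP; left; apply/imsetP; exists (x, u) => //.
  rewrite !inE xu negb_or uP /=.
  by move: uH; rewrite inE negb_or => /andP[].
- by apply: conn_sub wy; apply: subsetUl.
Qed.

(** Mirror image at the outputs: the heads of the unwanted edges leave [O], which costs a reachable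
    set at most half of its guaranteed [n / K] outputs. *)
Lemma robust_back K n h R S rs I O P H0 :
    robust K n h (rcons (rcons rs R) S) I O ->
    2 * K * #|[set e in S | e.1 \notin P :|: H0]| <= n ->
  exists O', robust (2 * K) n (h + #|H0|) (rcons rs (relcomp P R S)) I O'.
Proof.
case=> nI rob; set M := [set e in S | _] => le.
exists (O :\: [set e.2 | e in M]); split; first nia.
move=> A H sA cA.
have [cH _] := leq_card_setU H H0.
have := rob A (H :|: H0) sA ltac:(lia).
set X := reach _ _ _; set Y := reach _ _ _ => nX.
have : #|X :&: O| <= #|Y :&: (O :\: [set e.2 | e in M])| + #|M|.
  have <- := cardsID [set e.2 | e in M] (X :&: O).
  rewrite addnC leq_add //; last first.
    by apply: leq_trans (leq_imset_card snd M); rewrite subset_leq_card ?subsetIr.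
  apply/subset_leq_card/subsetP => y; rewrite inE => /andP[yM /setIP[yX yO]].
  rewrite inE [in X in _ && X]inE yM yO /= andbT.
  case/reachP: yX => x xA /conn_rcons[w [/conn_rcons[u [xu uw wH]] wy yH]].
  apply/reachP; exists x => //; apply/conn_rcons; exists u; split.
  - by apply: conn_sub xu; apply: subsetUl.
  - apply/relcompP; exists w; split=> //; apply: contraNT yM => wP.
    apply/imsetP; exists (w, y) => //; rewrite !inE wy negb_or wP /=.
    by move: wH; rewrite inE negb_or => /andP[].
  - by move: yH; rewrite inE negb_or => /andP[].
nia.
Qed.

Lemma robust_edges K n h R rs I O :
  robust K n h (rcons rs R) I O -> h < #|I| -> n <= K * #|R|.
Proof.
case=> _ rob hI; have := rob I set0 (subxx _); rewrite cards0 => /(_ hI).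
suff : #|reach (rcons rs R) set0 I :&: O| <= #|R| by nia.
apply: leq_trans (leq_imset_card snd R); apply/subset_leq_card/subsetP => y.
rewrite inE => /andP[/reachP[x _ /conn_rcons[z [_ zy _]]] _].
by apply/imsetP; exists (z, y).
Qed.

End Networks.

(** * Lower bounds by induction on the depth *)

(** [r] stands for [n / (h + 1)]. *)
Definition lower_bound d (g : nat -> nat) := forall K0, exists K,
  forall (V : finType) (rs : seq {set V * V}) (I O : {set V}) n h r,
    size rs = d -> robust K0 n h rs I O -> K <= r -> r * h.+1 <= n ->
  n * g r <= K * edges rs.

Lemma lower_bound_le d g g' :
  (forall x, g x <= g' x) -> lower_bound d g' -> lower_bound d g.
Proof.
move=> le lb K0; have [K KP] := lb K0; exists K => V rs I O n h r *.
by apply: leq_trans (KP V rs I O n h r _ _ _ _) => //; rewrite leq_mul2l le orbT.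
Qed.

(** If [h.+1] inputs had out-degree below [n / (K0 * h.+1)], together they would reach fewer than
    [n / K0] outputs. So all but [h] inputs have at least that out-degree. *)
Lemma lower_bound1 : lower_bound 1 id.
Proof.
(* The part [2 * K0] ensures [2 * h.+1 <= #|I|], so that at least half of the inputs have large
   degree; [2 * K0 ^ 2] is the constant of the edge bound. *)
move=> K0; exists (2 * K0 ^ 2 + 2 * K0) => V [|R [|//]] // I O n h r _ [nI rob] Kr rn.
rewrite /edges big_seq1.
pose U := [set x in I | K0 * h.+1 * outdeg R x < n].
have Uh : #|U| <= h.
  rewrite leqNgt; apply/negP => /card_geqP[s [us ss sU]].
  pose A := [set x in s].
  have cA : #|A| = h.+1 by rewrite cardsE (card_uniqP us).
  have AI : A \subset I.
    by apply/subsetP => x; rewrite inE => /sU; rewrite inE => /andP[].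
  have := rob A set0 AI; rewrite cards0 cA ltnS leqnn => /(_ isT).
  suff : #|reach [:: R] set0 A :&: O| <= \sum_(x in A) outdeg R x.
    have : \sum_(x in A) (K0 * h.+1 * outdeg R x).+1 <= \sum_(x in A) n.
      by apply: leq_sum => x; rewrite inE => /sU; rewrite inE => /andP[].
    rewrite sum_nat_const cA.
    under eq_bigr do rewrite -addn1.
    rewrite big_split /= sum1_card cA -big_distrr /=; set X := \sum_(_ in _) _.
    move=> le XX /leq_trans -/(_ (K0 * X)); rewrite leq_mul2l XX orbT => /(_ isT) nX.
    have : h.+1 * n <= h.+1 * (K0 * X) by rewrite leq_mul2l nX orbT.
    by move: le; rewrite mulnA (mulnC h.+1 K0); lia.
  have sub : reach [:: R] set0 A :&: O \subset
      \bigcup_(x in A) [set y | (x, y) \in R].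
    apply/subsetP => y /setIP[/reachP[x xA /conn_cons[z [_ xz /andP[_ /eqP <-]]]] _].
    by apply/bigcupP; exists x => //; rewrite inE.
  apply: leq_trans (subset_leq_card sub) _.
  apply: (big_rec2 (fun (X : {set V}) k => #|X| <= k)); first by rewrite cards0.
  move=> y k X _ Xk; apply: leq_trans (leq_card_setU _ _).1 _.
  by rewrite leq_add2l.
have : (#|I| - h) * n <= K0 * h.+1 * #|R|.
  rewrite -sum_outdegT big_distrr /=.
  apply: (@leq_trans (\sum_(x in I :\: U) K0 * h.+1 * outdeg R x)).
    apply: (@leq_trans (\sum_(x in I :\: U) n)).
      rewrite sum_nat_const leq_mul2r; apply/orP; right.
      have IU : #|I :&: U| <= #|U| := subset_leq_card (subsetIr _ _).
      by rewrite leq_subLR -(cardsID U I) leq_add2r (leq_trans IU Uh).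
    by apply: leq_sum => x; rewrite !inE => /andP[+ xI]; rewrite xI /= -leqNgt.
  by rewrite [X in _ <= X](bigID (mem (I :\: U))) /= leq_addr.
have [K00|K00] := posnP K0.
  by move: nI; rewrite K00 mul0n leqn0 => /eqP ->.
have hI : 2 * h.+1 <= #|I|.
  rewrite -(@leq_pmul2l K0) //; apply: leq_trans nI; apply: leq_trans rn.
  rewrite mulnA leq_mul2r; apply/orP; right; nia.
move: #|I| #|R| nI hI => i e nI hI le.
have le2 : i * n <= 2 * K0 * h.+1 * e.
  have : i * n <= 2 * ((i - h) * n) by rewrite mulnA leq_mul2r; apply/orP; right; lia.
  by nia.
have : h.+1 * (n * r) <= h.+1 * (2 * K0 ^ 2 * e).
  apply: (@leq_trans (n * n)); first by rewrite mulnCA leq_mul2l mulnC rn orbT.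
  apply: (@leq_trans (K0 * i * n)); first by rewrite leq_mul2r nI orbT.
  by rewrite -mulnA (leq_trans (leq_mul (leqnn K0) le2)) //; nia.
rewrite leq_pmul2l // => /leq_trans; apply.
by rewrite leq_mul2r leq_addr orbT.
Qed.

(** The bound [2 ^ J.+1] carries the induction: when a new term is present, the earlier sum is at
    most that term, which is at most [d]. *)
Lemma sum_pow2_le d J :
  \sum_(j < J) (2 ^ j.+1 <= d) * 2 ^ j.+1 <= minn (2 * d) (2 ^ J.+1).
Proof.
elim: J => [|J IH]; first by rewrite big_ord0.
rewrite big_ord_recr /= (expnS 2 J.+1).
by case: (leqP (2 ^ J.+1) d) IH => /=; rewrite ?mul1n ?mul0n; lia.
Qed.

(** The summand [2 * (d < 2 ^ J)] strengthens the induction: while [d < 2 ^ J], passing to [J.+1]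
    exactly doubles both sides. The first conjunct serves at the scale where the series starts. *)
Lemma sum_pow2_gt d J :
  (2 ^ J <= d -> \sum_(j < J) (d < 2 ^ j.+1) * 2 ^ (J - j) = 0) /\
  d * (\sum_(j < J) (d < 2 ^ j.+1) * 2 ^ (J - j) + 2 * (d < 2 ^ J)) <= 4 * 2 ^ J.
Proof.
elim: J => [|J [IH0 IH]]; first by rewrite big_ord0; case: d => // d; lia.
have -> : \sum_(j < J.+1) (d < 2 ^ j.+1) * 2 ^ (J.+1 - j) =
    2 * \sum_(j < J) (d < 2 ^ j.+1) * 2 ^ (J - j) + 2 * (d < 2 ^ J.+1).
  rewrite big_ord_recr /= subSnn expn1 [in X in _ = _ + X]mulnC; congr (_ + _).
  rewrite big_distrr /=; apply: eq_bigr => j _.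
  by rewrite (subSn (ltnW (ltn_ord j))) (expnS 2 (J - j)) mulnCA.
move: IH IH0; set X := \sum_(_ < _) _; rewrite (expnS 2 J).
case: (ltnP d (2 ^ J)) => dJ; case: (ltnP d (2 * 2 ^ J)) => dJ'; split; nia.
Qed.

Lemma sum_ge_from k c J (F : nat -> nat) :
  (forall j, j < J -> k <= j -> c <= F j) -> (J - k) * c <= \sum_(j < J) F j.
Proof.
elim: J => [//|J IH] le; rewrite big_ord_recr /=.
have {}IH := IH (fun j jJ => le j (ltnW jJ)).
have [kJ|kJ] := leqP k J; first by rewrite subSn // mulSnr leq_add // le.
by rewrite (eqP (_ : J.+1 - k == 0)) // subn_eq0.
Qed.

(** At each scale [2 ^ j], either the middle vertices of degree at least
    [2 ^ j.+1] are numerous, or those of smaller degree have a large sum of squared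
    degrees.  Summed over [j], both contributions of a single vertex are geometric
    series, of the order of its degree. *)
Lemma lower_bound2 : lower_bound 2 (up_log 2).
Proof.
move=> K0; have [K1 lb1] := lower_bound1 (2 * K0).
(* The power of two forces [2 * K1 + 1 <= J], hence [J.+1 <= 2 * (J - K1)]: enough scales remain
   when the lowest [K1] are dropped. *)
exists (2 * (2 + 4 * K1) + 2 ^ (2 * K1 + 1)).
move=> V [|R [|S [|//]]] // I O n h r _ rob Kr rn.
rewrite /edges big_cons big_seq1.
pose f v := indeg R v + outdeg S v.
have <- : \sum_v f v = #|R| + #|S| by rewrite big_split /= sum_indegT sum_outdegT.
set J := trunc_log 2 r.
have r1 : 1 < r by have := expn_gt0 2 (2 * K1 + 1); lia.
have Jr : 2 ^ J <= r by apply: trunc_logP => //; lia.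
have step j : j < J -> K1 <= j -> n * 2 ^ j <=
    2 ^ j * (2 ^ j.+1 * #|[set v | 2 ^ j.+1 <= f v]|) +
    K1 * \sum_v (f v < 2 ^ j.+1) * (f v * f v).
  move=> jJ Kj; set H := [set v | _].
  have [nH|Hn] := ltnP n (2 ^ j.+1 * #|H|).
    by apply: leq_trans (leq_addr _ _); rewrite mulnC leq_mul2l ltnW ?orbT.
  (* With [P] the complement of [H] there is no middle range, and no edge of [R] is unwanted. *)
  have [|I' rob'] := robust_front (P := ~: H) (H0 := H) rob.
    rewrite (_ : [set _ in _ | _] = set0) ?cards0 ?muln0 //.
    by apply/setP => e; rewrite !inE orNb andbF.
  have j2 : K1 <= 2 ^ j by rewrite (leq_trans Kj) // ltnW // ltn_expl.
  have jr : 2 ^ j.+1 <= r by rewrite (leq_trans _ Jr) // leq_exp2l.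
  have := lb1 _ [:: _] _ _ _ _ (2 ^ j) erefl rob' j2.
  have -> : 2 ^ j * (h + #|H|).+1 <= n.
    have : 2 ^ j.+1 * h.+1 <= n by apply: leq_trans rn; rewrite leq_mul2r jr orbT.
    by move: Hn; rewrite expnS; nia.
  move=> /(_ isT) /leq_trans; apply.
  rewrite /edges big_seq1 (leq_trans _ (leq_addl _ _)) // leq_mul2l.
  apply/orP; right; apply: leq_trans (card_relcomp _ _ _) _.
  rewrite big_mkcond /=; apply: leq_sum => v _; rewrite !inE -ltnNge.
  by case: ltnP => // _; rewrite mul1n /f; nia.
(* Rescaling [step] by [2 ^ (J - j)] makes its left-hand side independent of [j], so that the scales
   can be added up. *)
pose F j := 2 ^ J * (2 ^ j.+1 * #|[set v | 2 ^ j.+1 <= f v]|) +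
    K1 * \sum_v f v * (f v * ((f v < 2 ^ j.+1) * 2 ^ (J - j))).
have stepF j : j < J -> K1 <= j -> n * 2 ^ J <= F j.
  move=> jJ Kj; have := step j jJ Kj.
  rewrite -(@leq_pmul2r (2 ^ (J - j)) (n * 2 ^ j)) ?expn_gt0 //.
  rewrite -mulnA -expnD (subnKC (ltnW jJ)) => /leq_trans; apply.
  rewrite mulnDl leq_add //.
    by rewrite mulnAC -expnD (subnKC (ltnW jJ)).
  rewrite -mulnA leq_mul2l; apply/orP; right.
  by rewrite big_distrl; apply: leq_sum => v _ /=; nia.
have := sum_ge_from stepF; rewrite big_split /= -!big_distrr /=.
rewrite exchange_big /=.
have -> : \sum_(j < J) 2 ^ j.+1 * #|[set v | 2 ^ j.+1 <= f v]| =
   \sum_v \sum_(j < J) (2 ^ j.+1 <= f v) * 2 ^ j.+1.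
  rewrite exchange_big /=; apply: eq_bigr => j _.
  rewrite -sum1_card big_distrr big_mkcond /=; apply: eq_bigr => v _.
  by rewrite inE; case: ifP => _; rewrite ?muln1 ?mul1n.
have le1 : \sum_v \sum_(j < J) (2 ^ j.+1 <= f v) * 2 ^ j.+1 <= 2 * \sum_v f v.
  rewrite big_distrr; apply: leq_sum => v _.
  by apply: leq_trans (sum_pow2_le _ _) (geq_minl _ _).
have le2 : \sum_v \sum_(j < J) f v * (f v * ((f v < 2 ^ j.+1) * 2 ^ (J - j)))
    <= 4 * 2 ^ J * \sum_v f v.
  rewrite big_distrr; apply: leq_sum => v _; rewrite -!big_distrr /=.
  rewrite [X in _ <= X]mulnC leq_mul2l; apply/orP; right.
  by apply: leq_trans (sum_pow2_gt (f v) J).2; rewrite leq_mul2l leq_addr orbT.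
move=> le.
have {}le : (J - K1) * n <= (2 + 4 * K1) * \sum_v f v.
  rewrite -(@leq_pmul2r (2 ^ J)) ?expn_gt0 // -mulnA (leq_trans le) //.
  have := leq_add (leq_mul (leqnn (2 ^ J)) le1) (leq_mul (leqnn K1) le2).
  by move/leq_trans; apply; nia.
have KJ : 2 * K1 + 1 <= J by apply: trunc_log_max => //; lia.
have lr : up_log 2 r <= J.+1.
  by apply: up_log_min => //; apply: ltnW; apply: trunc_log_ltn.
apply: (@leq_trans (n * (2 * (J - K1)))).
  by rewrite leq_mul2l; apply/orP; right; lia.
apply: (@leq_trans (2 * ((2 + 4 * K1) * \sum_v f v))); last by nia.
by nia.
Qed.

(** These properties yield the thresholds below and pass from [g] to [star g], so that the step in
    depth can be iterated. *)
Record tame (g : nat -> nat) : Prop := Tame {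
  tame_mono : {homo g : x y / x <= y};
  tame_lt : forall x, 1 < x -> g x < x;
  tame_sqr : exists z0, forall x, z0 <= x -> g x * g x <= x
}.

(** The thresholds are [D i = iter (5 * (p - i)) g r]: as [g x] is at most
    [sqrt x], five iterations of [g] absorb the factor [star g r] and the square
    of [D i], as long as the iterates stay above [star g r]. *)
Lemma star_thresholds g W : tame g -> exists C, forall r, 1 < r ->
  exists p (D : nat -> nat),
  [/\ star g r <= 10 * p + C, D p <= r,
      forall i, i < p -> 1 <= D i <= D i.+1 &
      forall i, i < p -> exists r', [/\ W <= r', 2 * r' * star g r <= D i.+1 &
        D i ^ 2 * star g r < g r']].
Proof.
case=> gm glt [z0 gsq]; exists (2 * (W + z0) + 10) => r r1.
have [/andP[s0 sr] _ smin] := starP glt r1.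
set s := star g r in s0 sr smin *.
have [y [y0 yS y2]] : exists y : nat -> nat, [/\ y 0 = r,
    forall j, y j.+1 = g (y j) & forall j, j < s -> 1 < y j].
  exists (fun j => iter j g r); split=> // -[//|j] js.
  by rewrite ltnNge; apply/negP => /(smin _ (ltn0Sn j)); rewrite leqNgt js.
have ylt j : j < s -> y j.+1 < y j by move=> js; rewrite yS; apply/glt/y2.
have ylin m : m < s -> m + 2 <= y (s - 1 - m).
  elim: m => [|m IH] ms; first by apply: y2; lia.
  have := ylt (s - 1 - m.+1) ltac:(lia).
  by rewrite (_ : (s - 1 - m.+1).+1 = s - 1 - m); [have := IH ltac:(lia); lia | lia].
(* The last [Z] iterates are given up so that the others exceed [z0] and [W]; a further [s %/ 2]
   squarings lift the iterates above [s]. The remaining ones are grouped in fives. *)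
pose Z := W + z0; pose p := (s - s %/ 2 - 1 - Z) %/ 5.
have yZ j : j + Z < s -> Z + 2 <= y j.
  move=> js; have := ylin (s - 1 - j) ltac:(lia).
  by rewrite (_ : s - 1 - (s - 1 - j) = j); lia.
have ysq j : j + Z < s -> y j.+1 * y j.+1 <= y j.
  by move=> js; rewrite yS; apply: gsq; have := yZ j js; rewrite /Z; lia.
have yexp m : m + Z < s -> 2 ^ m.+1 <= y (s - 1 - Z - m).
  elim: m => [|m IH] ms; first by apply: y2; lia.
  have := ysq (s - 1 - Z - m.+1) ltac:(lia).
  rewrite (_ : (s - 1 - Z - m.+1).+1 = s - 1 - Z - m); last lia.
  have {}IH := IH ltac:(lia).
  have m2 : 2 <= 2 ^ m.+1 by rewrite -{1}(expn1 2) leq_exp2l.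
  by apply: leq_trans; rewrite expnS (leq_mul (leq_trans m2 IH) IH).
have p5 : 0 < p -> 5 * p + Z + s %/ 2 < s by rewrite /p; lia.
have ys j : 0 < p -> j <= 5 * p -> s <= y j.
  move=> p0 jp; have := yexp (s - 1 - Z - j) ltac:(have := p5 p0; lia).
  rewrite (_ : s - 1 - Z - (s - 1 - Z - j) = j); last by have := p5 p0; lia.
  apply: leq_trans; apply: leq_trans (_ : 2 ^ (s %/ 2).+1 <= _).
    by have := ltn_expl (s %/ 2) (isT : 1 < 2); rewrite expnS; lia.
  by rewrite leq_exp2l //; have := p5 p0; lia.
exists p, (fun i => y (5 * (p - i))); split.
- by rewrite /p /Z; lia.
- by rewrite subnn y0.
- move=> i ip; have p0 : 0 < p by lia.
  have := p5 p0 => pp.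
  rewrite (_ : 5 * (p - i) = (5 * (p - i.+1)).+4.+1); last lia.
  set j := 5 * _; have := ylt j; have := ylt j.+1; have := ylt j.+2.
  have := ylt j.+3; have := ylt j.+4; have := y2 j.+4.+1; lia.
move=> i ip; have p0 : 0 < p by lia.
have := p5 p0 => pp.
rewrite (_ : 5 * (p - i) = (5 * (p - i.+1)).+4.+1); last lia.
have : 5 * (p - i.+1) + 5 <= 5 * p by lia.
set j := 5 * _ => jp; exists (y j %/ (2 * s)).
have h1 := ysq j ltac:(lia); have h2 := ysq j.+1 ltac:(lia).
have h3 := ysq j.+2 ltac:(lia); have h4 := ysq j.+3 ltac:(lia).
have h5 := ysq j.+4 ltac:(lia); have k := ys j.+4.+1 p0 ltac:(lia).
have k2 := yZ j.+4.+1 ltac:(lia).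
have l1 := ylt j.+4 ltac:(lia); have l2 := ylt j.+3 ltac:(lia).
have l3 := ylt j.+2 ltac:(lia).
(* Two iterations absorb the factor [2 * s]. Applying [g] once more gives [y j.+3 <= g r'], and the
   last two iterations put the fourth power of [y j.+5] below this, which beats its square times
   [s]. *)
have le : y j.+2 <= y j %/ (2 * s).
  rewrite leq_divRL; last lia.
  apply: leq_trans h1; apply: leq_trans (leq_mul h2 h2).
  by rewrite leq_mul ?leq_pmulr ?leq_mul //; lia.
split.
- by apply: leq_trans le; rewrite /Z in k2; lia.
- by have := leq_divM (y j) (2 * s); lia.
- apply: leq_trans (gm _ _ le); rewrite -yS.
  apply: leq_trans h4; have {}h5 := leq_mul h5 h5.
  apply: leq_trans h5; rewrite -mulnn ltn_pmul2l ?muln_gt0; last lia.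
  by apply: (leq_ltn_trans k); rewrite -{1}(muln1 (y _)) ltn_pmul2l; lia.
Qed.

Lemma sum_ranges (T : finType) (X : {set T}) (f : T -> nat) (D : nat -> nat) p :
    (forall i, i < p -> D i <= D i.+1) ->
  \sum_(i < p) #|[set e in X | D i < f e <= D i.+1]| <= #|X|.
Proof.
move=> Dle; apply: leq_trans (_ : #|[set e in X | f e <= D p]| <= _); last first.
  by apply/subset_leq_card/subsetP => e; rewrite inE => /andP[].
elim: p Dle => [|p IH] Dle; first by rewrite big_ord0.
rewrite big_ord_recr /=.
have {}IH := IH (fun i ip => Dle i (ltnW ip)).
apply: leq_trans (leq_add IH (leqnn _)) _.
rewrite -[X in _ <= X](cardsID [set e | f e <= D p]) leq_add //.
  apply/subset_leq_card/subsetP => e; rewrite !inE => /andP[-> fe].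
  by rewrite fe (leq_trans fe) // Dle.
by apply/subset_leq_card/subsetP => e; rewrite !inE -ltnNge => /and3P[-> -> ->].
Qed.

Lemma lower_bound_star d g :
  0 < d -> tame g -> lower_bound d g -> lower_bound d.+2 (star g).
Proof.
move=> d0 gt lb K0; have [K1 lb1] := lb (2 * (2 * K0)).
have [C CP] := star_thresholds K1 gt.
exists (K1 + 2 + K0 + (40 * K0 + C * K0)) => V rs I O n h r szrs rob Kr rn.
set K := K1 + 2 + K0 + _.
have r1 : 1 < r by lia.
have [p [D [sp Dr Dmono DP]]] := CP r r1.
set s := star g r in sp DP *.
case: rs szrs rob => // R rs' [szrs]; case/lastP: rs' szrs => // rs S.
rewrite size_rcons => -[szrs] rob.
(* A linear bound on the edges absorbs the additive constant in [star g r <= 10 * p + C]. *)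
have KE : n <= K0 * #|S|.
  apply: (@robust_edges _ _ _ h S (R :: rs) I O) => //.
  have [nI _] := rob.
  have [K00|K00] := posnP K0; first by move: nI rn Kr; rewrite K00 mul0n; nia.
  rewrite -(ltn_pmul2l K00); apply: leq_trans nI; apply: leq_trans rn.
  nia.
set E := edges _.
have EE : E = #|R| + (edges rs + #|S|).
  by rewrite /E /edges big_cons -cats1 big_cat big_seq1.
rewrite leqNgt; apply/negP => Ens.
pose M i := #|[set e in R | D i < indeg R e.2 <= D i.+1]|.
pose N i := #|[set e in S | D i < outdeg S e.1 <= D i.+1]|.
(* If every range were heavy, the disjoint ranges would give more than [p * n / (4 * K0)] edges in
   all, which is already enough. *)
case: (boolP [exists i : 'I_p, 4 * K0 * (M i + N i) <= n]); last first.
  rewrite negb_exists => /forallP Mn.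
  have : \sum_(i < p) n <= \sum_(i < p) 4 * K0 * (M i + N i).
    by apply: leq_sum => i _; apply: ltnW; rewrite ltnNge Mn.
  rewrite sum_nat_const card_ord -big_distrr big_split /= => pn.
  have Dle j : j < p -> D j <= D j.+1 by case/Dmono/andP.
  have := sum_ranges R (fun e => indeg R e.2) Dle; rewrite -/(M _) => MR.
  have := sum_ranges S (fun e => outdeg S e.1) Dle => NS.
  have {}pn : p * n <= 4 * K0 * E.
    apply: leq_trans pn _; rewrite leq_mul2l; apply/orP; right.
    by rewrite EE leq_add // (leq_trans NS) // leq_addl.
  have sn : n * s <= (40 * K0 + C * K0) * E.
    apply: (@leq_trans (n * (10 * p + C))); first by rewrite leq_mul2l sp orbT.
    rewrite mulnDr mulnDl leq_add //; first by lia.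
    rewrite mulnC -mulnA leq_mul2l; apply/orP; right.
    by apply: leq_trans KE _; rewrite leq_mul2l EE; lia.
  have := leq_trans Ens sn; rewrite ltnNge leq_mul2r /K.
  by rewrite leq_addl orbT.
case/existsP => -[i ip] /= iMN.
have [r' [Kr' r's Dg]] := DP i ip; have /andP[Di1 Di2] := Dmono i ip.
pose P1 := [set v | indeg R v <= D i]; pose H1 := [set v | D i.+1 < indeg R v].
pose P2 := [set v | outdeg S v <= D i]; pose H2 := [set v | D i.+1 < outdeg S v].
clearbody E.
case: rs szrs rob EE => [|T rs] szrs rob EE; first by rewrite -szrs in d0.
have [I' rob'] : exists I', robust (2 * K0) n (h + #|H1|)
    (relcomp P1 R T :: rcons rs S) I' O.
  apply: robust_front rob _; apply: leq_trans iMN.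
  rewrite (_ : [set e in R | _] = [set e in R | D i < indeg R e.2 <= D i.+1]).
    by rewrite -/(M i); nia.
  by apply/setP => e; rewrite !inE negb_or -ltnNge -leqNgt.
(* For [d = 1] the last layer [U] before [S] is the composite layer just formed. *)
move: rob'; rewrite -rcons_cons; have [rs1 [U rsU]] : exists rs1 U,
    relcomp P1 R T :: rs = rcons rs1 U.
  by exists (belast (relcomp P1 R T) rs), (last (relcomp P1 R T) rs); apply: lastI.
rewrite rsU => rob'.
have [O' rob2] : exists O', robust (2 * (2 * K0)) n (h + #|H1| + #|H2|)
    (rcons rs1 (relcomp P2 U S)) I' O'.
  apply: robust_back rob' _; apply: leq_trans iMN.
  rewrite (_ : [set e in S | _] = [set e in S | D i < outdeg S e.1 <= D i.+1]).
    by rewrite -/(N i); nia.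
  by apply/setP => e; rewrite !inE negb_or -ltnNge -leqNgt.
have szd : size (rcons rs1 (relcomp P2 U S)) = d.
  by have := congr1 size rsU; rewrite !size_rcons /= => <-.
have HE : D i.+1 * (#|H1| + #|H2|) <= E.
  have H1R := card_ge_le_sum (indeg R) (D i.+1).+1.
  have H2S := card_ge_le_sum (outdeg S) (D i.+1).+1.
  rewrite sum_indegT -/H1 in H1R; rewrite sum_outdegT -/H2 in H2S.
  by rewrite EE; move: H1R H2S; rewrite !mulSn; lia.
have edgesE : edges (rcons rs1 (relcomp P2 U S)) <= D i ^ 2 * E.
  have e1 : edges (relcomp P1 R T :: rs) <= D i * edges (T :: rs).
    rewrite /edges !big_cons mulnDr leq_add //.
      by apply: card_relcomp_in => v; rewrite inE.
    by rewrite -{1}(mul1n (\sum_(_ <- _) _)) leq_mul2r Di1 orbT.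
  have e2 : edges (rcons rs1 (relcomp P2 U S)) <= D i * edges (rcons rs1 U).
    rewrite /edges -!cats1 !big_cat !big_seq1 /= mulnDr leq_add //.
      by rewrite -{1}(mul1n (\sum_(_ <- _) _)) leq_mul2r Di1 orbT.
    by apply: card_relcomp_out => v; rewrite inE.
  apply: leq_trans e2 _; rewrite -mulnn -mulnA leq_mul2l; apply/orP; right.
  by rewrite -rsU (leq_trans e1) // leq_mul2l EE; lia.
have EK : E <= K * E by rewrite -{1}(mul1n E) leq_mul2r /K; lia.
(* Half of [n] pays for the old deletions, as [2 * r' <= D i.+1 <= r]. The other half pays for the
   new ones: [HE] bounds their number by [E / D i.+1], where [E < n * s] and
   [2 * r' * s <= D i.+1]. *)
have rn' : r' * (h + #|H1| + #|H2|).+1 <= n.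
  have a1 : 2 * r' * h.+1 <= n.
    apply: leq_trans rn; rewrite leq_mul2r; apply/orP; right.
    have : D i.+1 <= r.
      apply: leq_trans Dr.
      have Dup k : i.+1 + k <= p -> D i.+1 <= D (i.+1 + k).
        elim: k => [|k IH] kp; first by rewrite addn0.
        rewrite addnS in kp *; apply: leq_trans (IH (ltnW kp)) _.
        by have /andP[] := Dmono _ kp.
      by have := Dup (p - i.+1); rewrite subnKC //; apply.
    apply: leq_trans; apply: leq_trans r's; rewrite leq_pmulr //.
    by move: Ens; case: (s) => //; rewrite muln0.
  have a2 : 2 * r' * (#|H1| + #|H2|) <= n.
    have s0 : 0 < s by move: Ens; case: (s) => //; rewrite muln0.
    rewrite -(leq_pmul2r s0); apply: ltnW; apply: leq_ltn_trans Ens.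
    apply: leq_trans EK; apply: leq_trans HE; rewrite mulnAC leq_mul2r.
    by rewrite r's orbT.
  by move: a1 a2; rewrite -addnA -addSn !mulnDr; lia.
have := lb1 _ _ _ _ _ _ _ szd rob2 Kr' rn'.
apply/negP; rewrite -ltnNge.
apply: leq_ltn_trans (_ : K1 * (D i ^ 2 * E) < _).
  by rewrite leq_mul2l edgesE orbT.
apply: leq_trans (_ : n * (D i ^ 2 * s) <= _); last by rewrite leq_mul2l (ltnW Dg) orbT.
rewrite mulnCA [X in _ < X]mulnCA ltn_pmul2l ?expn_gt0 ?Di1 //.
by apply: leq_ltn_trans Ens; rewrite leq_mul2r /K -!addnA leq_addr orbT.
Qed.

(** * Growth of the functions [lambda d] *)

Lemma star_min f n i : 0 < i -> iter i f n <= 1 -> 0 < star f n <= i.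
Proof.
move=> i0 iP; rewrite /star; case: pselect => [h|[]]; last by exists i; rewrite i0.
by case: ex_minnP => m /andP[-> _]; apply; rewrite i0.
Qed.

(** The square bound is inherited because [star g x <= g x]: after one iteration, fewer than [g x]
    further ones reach [1]. *)
Lemma tame_star g : tame g -> tame (star g).
Proof.
case=> gm glt [z0 gsq]; split.
- move=> m n mn; have [n1|n1] := ltnP 1 n.
    have [/andP[s0 _] sP _] := starP glt n1.
    have mP : iter (star g n) g m <= 1.
      by apply: leq_trans sP; elim: (star g n) => //= k; apply: gm.
    by have /andP[] := star_min s0 mP.
  have g1 k : k <= n -> g k <= 1.
    by move=> kn; rewrite -ltnS (leq_ltn_trans _ (glt 2 isT)) // gm //; lia.
  have /andP[_ sm] := @star_min g m 1 isT (g1 _ mn).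
  by have /andP[sn _] := @star_min g n 1 isT (g1 _ (leqnn _)); lia.
- by move=> x x1; have [/andP[]] := starP glt x1.
exists (z0 + 2) => x xz; have := gsq x ltac:(lia).
have [g1|g1] := leqP (g x) 1.
  by have /andP[_ s1] := @star_min g x 1 isT g1; nia.
suff : star g x <= g x by move=> le; apply: leq_trans; rewrite leq_mul.
have [/andP[_ slt] sP _] := starP glt g1.
by have /andP[_] := @star_min g x (star g (g x)).+1 isT ltac:(by rewrite iterSr); lia.
Qed.

Lemma tame_sqrt : tame Nat.sqrt.
Proof.
split; last by exists 0 => x _; have [] := PeanoNat.Nat.sqrt_spec x; lia.
- by move=> x y xy; apply/ssrnat.leP/PeanoNat.Nat.sqrt_le_mono/ssrnat.leP.
- by move=> x x1; apply/ssrnat.ltP/PeanoNat.Nat.sqrt_lt_lin/ssrnat.ltP.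
Qed.

Lemma tame_log : tame (up_log 2).
Proof.
split; first by move=> x y; apply: leq_up_log.
  exact: (@lambda_lt 2).
(* A logarithm [k] below [7] has square at most [36]; from [7] on, [k ^ 2 <= 2 ^ k.-1 < x]. *)
exists 49 => x x49; have [k7|k7] := ltnP (up_log 2 x) 7; first by nia.
apply: leq_trans (ltnW (up_log_gtn (isT : 1 < 2) _)); last lia.
case: (up_log 2 x) k7 => // k; rewrite ltnS /=.
elim: k => // k IH; rewrite leq_eqVlt => /predU1P[<- //|k6].
by have := IH k6; rewrite [2 ^ k.+1]expnS; nia.
Qed.

Lemma lambda_lower_bound d : 0 < d -> tame (lambda d) /\ lower_bound d (lambda d).
Proof.
elim/ltn_ind: d => -[|[|[|d]]] // IH _.
- split; first exact: tame_sqrt.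
  apply: lower_bound_le lower_bound1 => x.
  by apply/ssrnat.leP/PeanoNat.Nat.sqrt_le_lin.
- by split; [apply: tame_log | apply: lower_bound2].
have [gt lb] := IH d.+1 ltac:(lia) isT.
by split; [apply: tame_star | apply: lower_bound_star].
Qed.

(** * Entropy *)

Section Entropy.
Local Open Scope ring_scope.
Variable R : realType.

Lemma log2_ln (x : R) : log2 x * ln 2 = ln x.
Proof. by rewrite /log2 divfK // gt_eqF // ln_gt0 // ltr1n. Qed.

Lemma xlog2x_le0 (p : R) : 0 <= p <= 1 -> p * log2 p <= 0.
Proof.
move=> /andP[p0 p1]; rewrite mulr_ge0_le0 // /log2 pmulr_lle0 ?ln_le0 //.
by rewrite invr_gt0 ln_gt0 // ltr1n.
Qed.

Lemma xlog2x_eq0 (p : R) : 0 <= p <= 1 -> p * log2 p = 0 -> p = 0 \/ p = 1.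
Proof.
move=> /andP[p0 p1] /eqP; rewrite mulf_eq0 => /orP[/eqP|]; first by left.
rewrite /log2 mulf_eq0 invr_eq0 [_ || (ln 2 == 0)]orbC.
rewrite gt_eqF /= ?ln_gt0 ?ltr1n // => /eqP ln0'.
move: p0; rewrite le_eqVlt => /predU1P[<-|p0]; first by left.
by right; rewrite -(lnK p0) ln0' expR0.
Qed.

(** Gibbs' inequality against the uniform law; its defect bounds the
    proportion of outcomes with probability [0]. *)
Lemma entropy_defect (A : finType) (p : A -> R) :
    (0 < #|A|)%N -> (forall a, 0 <= p a) -> \sum_a p a = 1 ->
  - (\sum_a p a * ln (p a)) <=
    ln #|A|%:R + (#|[set a | 0 < p a]|%:R / #|A|%:R - 1).
Proof.
move=> A0 p0 p1; set q : R := #|A|%:R; have q0 : 0 < q by rewrite ltr0n.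
have -> : #|[set a | 0 < p a]|%:R / q = \sum_a (if 0 < p a then q^-1 else 0).
  rewrite mulr_natl -sumr_const big_mkcond /=.
  by apply: eq_bigr => a _; rewrite inE.
have -> : ln q = \sum_a p a * ln q by rewrite -mulr_suml p1 mul1r.
rewrite -p1 -!sumrB -sumrN -big_split /=; apply: ler_sum => a _.
have := p0 a; rewrite le_eqVlt => /predU1P[<-|pa]; first by rewrite ltxx; lra.
rewrite pa; have := @le_ln1Dx R ((p a * q)^-1 - 1).
have -> : 1 + ((p a * q)^-1 - 1) = (p a * q)^-1 by ring.
rewrite lnV ?posrE ?mulr_gt0 // lnM ?posrE //.
have ipq : 0 < (p a * q)^-1 by rewrite invr_gt0 mulr_gt0.
move=> /(_ ltac:(lra)) le; have := ler_wpM2l (p0 a) le.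
have -> : p a * ((p a * q)^-1 - 1) = q^-1 - p a.
  by field; rewrite !gt_eqF.
lra.
Qed.

Variables (Om A B : finType) (P : Om -> R) (X : Om -> A) (Y : Om -> B).
Hypothesis P_gt0 : forall w, 0 < P w.

Lemma pr_ge0 (E : pred Om) : 0 <= pr P E.
Proof. by apply: sumr_ge0 => w _; apply: ltW. Qed.

Lemma pr_gt0P (E : pred Om) : reflect (exists w, E w) (0 < pr P E).
Proof.
apply: (iffP idP) => [|[w Ew]].
  case: (pickP E) => [w Ew _|E0]; first by exists w.
  by rewrite /pr big_pred0 ?ltxx.
rewrite /pr (bigD1 w) //= ltr_wpDr //.
by apply: sumr_ge0 => v _; apply: ltW.
Qed.

Lemma sum_pr (E : pred Om) :
  \sum_a pr P [pred w | (X w == a) && E w] = pr P E.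
Proof.
rewrite /pr (partition_big X xpredT) //=; apply: eq_bigr => a _.
by apply: eq_bigl => w; rewrite andbC.
Qed.

Let pb b := pr P [pred w | Y w == b].
Let pc b a := pr P [pred w | (X w == a) && (Y w == b)] / pb b.

Lemma pc_ge0 b a : 0 <= pc b a.
Proof. by rewrite /pc divr_ge0 ?pr_ge0. Qed.

Lemma sum_pc b : 0 < pb b -> \sum_a pc b a = 1.
Proof.
by move=> b0; rewrite -mulr_suml sum_pr divff // gt_eqF.
Qed.

Lemma pc_le1 b a : 0 < pb b -> pc b a <= 1.
Proof.
move=> b0; rewrite -(sum_pc b0) (bigD1 a) //= lerDl.
by apply: sumr_ge0 => a' _; apply: pc_ge0.
Qed.

(** Every term of the average vanishes, so each conditional probability is [0] or [1]. As all
    outcomes have positive probability, distinct [X w] and [X w'] would both get conditional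
    probability [1]. *)
Lemma cond_entropy_eq0 w w' :
  cond_entropy P X Y = 0 -> Y w = Y w' -> X w = X w'.
Proof.
rewrite /cond_entropy /= => H Yw.
have b0 : 0 < pb (Y w) by apply/pr_gt0P; exists w; rewrite /= eqxx.
have := psumr_eq0P _ H => /(_ _ (Y w) isT) H'.
have {}H' : - \sum_a pc (Y w) a * log2 (pc (Y w) a) = 0.
  apply/eqP; have := H' _; rewrite -/(pb (Y w)) => /(_ _)/eqP.
  rewrite mulf_eq0 (gt_eqF b0) /=; apply => b _.
  have [bb|bb] := ltP 0 (pb b); last first.
    by rewrite (_ : pr P _ = 0) ?mul0r //; apply/eqP; rewrite eq_le bb pr_ge0.
  rewrite mulr_ge0 ?pr_ge0 // oppr_ge0; apply: sumr_le0 => a _.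
  by apply: xlog2x_le0; rewrite pc_ge0 pc_le1.
have pc01 a : pc (Y w) a = 0 \/ pc (Y w) a = 1.
  apply: xlog2x_eq0; first by rewrite pc_ge0 pc_le1.
  move: H'; rewrite -sumrN => /psumr_eq0P H'; apply: oppr_inj; rewrite oppr0.
  apply: H' => // a' _; rewrite oppr_ge0.
  by apply: xlog2x_le0; rewrite pc_ge0 pc_le1.
have pc1 u : Y u = Y w -> pc (Y w) (X u) = 1.
  move=> Yu; case: (pc01 (X u)) => // /eqP; rewrite gt_eqF // divr_gt0 //.
  by apply/pr_gt0P; exists u; rewrite /= Yu !eqxx.
apply/eqP/negP => /negP XX; have := sum_pc b0.
rewrite (bigD1 (X w)) //= (bigD1 (X w')) 1?eq_sym //= !pc1 //.
have : 0 <= \sum_(i | (i != X w) && (i != X w')) pc (Y w) i.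
  by apply: sumr_ge0 => a _; apply: pc_ge0.
by move=> *; lra.
Qed.

(** An average that equals the maximum [ln #|A|] attains it at every [b] of positive probability; by
    [entropy_defect] the conditional law then has full support. *)
Lemma cond_entropy_full w a :
    (\sum_w P w = 1) -> cond_entropy P X Y = log2 #|A|%:R ->
  exists w', Y w' = Y w /\ X w' = a.
Proof.
move=> P1 H; have A0 : (0 < #|A|)%N by apply/card_gt0P; exists a.
pose h b := - \sum_a pc b a * ln (pc b a).
have hE : \sum_b pb b * h b = ln #|A|%:R.
  rewrite -log2_ln -H /cond_entropy mulr_suml; apply: eq_bigr => b _ /=.
  rewrite -mulrA; congr (_ * _); rewrite mulNr mulr_suml /h; congr (- _).
  by apply: eq_bigr => a' _; rewrite -[RHS]mulrA log2_ln.
have pb1 : \sum_b pb b = 1.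
  by rewrite -P1 [RHS](partition_big Y xpredT).
have b0 : 0 < pb (Y w) by apply/pr_gt0P; exists w; rewrite /= eqxx.
pose k b := #|[set a | 0 < pc b a]|.
have q0 : 0 < #|A|%:R :> R by rewrite ltr0n.
have kA b : (k b)%:R / #|A|%:R <= 1 :> R.
  by rewrite ler_pdivrMr // mul1r ler_nat max_card.
have hle b : 0 < pb b -> h b <= ln #|A|%:R + ((k b)%:R / #|A|%:R - 1).
  by move=> bb; apply: entropy_defect; rewrite ?sum_pc // => a'; apply: pc_ge0.
have : \sum_b pb b * (ln #|A|%:R - h b) = 0.
  under eq_bigr do rewrite mulrBr.
  by rewrite sumrB hE -mulr_suml pb1 mul1r subrr.
move/psumr_eq0P => /(_ _ (Y w) isT) hw.
have {hw} : pb (Y w) * (ln #|A|%:R - h (Y w)) = 0.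
  apply: hw => b _; have [bb|bb] := ltP 0 (pb b).
    by rewrite mulr_ge0 ?pr_ge0 // subr_ge0; have := hle b bb; have := kA b; lra.
  by rewrite (_ : pb b = 0) ?mul0r //; apply/eqP; rewrite eq_le bb pr_ge0.
move/eqP; rewrite mulf_eq0 (gt_eqF b0) /= subr_eq0 => /eqP hq.
have : (k (Y w))%:R / #|A|%:R >= 1 :> R by have := hle _ b0; rewrite -hq; lra.
rewrite ler_pdivlMr // mul1r ler_nat => kq.
have : [set a | 0 < pc (Y w) a] == setT.
  by rewrite eqEcard subsetT cardsT.
move=> /eqP/setP/(_ a); rewrite !inE => pa.
have : 0 < pr P [pred w' | (X w' == a) && (Y w' == Y w)].
  by move: pa; rewrite /pc pmulr_lgt0 // invr_gt0.
by case/pr_gt0P => w' /andP[/eqP <- /eqP <-]; exists w'.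
Qed.

End Entropy.

(** * Independent uniform inputs *)

Section UniformInputs.
Local Open Scope ring_scope.
Variables (R : realType) (F : finFieldType) (t : nat).

Lemma indep_uniformE (x : {ffun 'I_t -> F}) :
  indep_uniform R x = (#|F|%:R^-1) ^+ t.
Proof.
by rewrite /indep_uniform /uniform_dist prodr_const card_ord.
Qed.

Lemma card_field_gt0 : 0 < #|F|%:R :> R.
Proof. by rewrite ltr0n (ltnW (card_finNzRing_gt1 _)). Qed.

Lemma indep_uniform_gt0 (x : {ffun 'I_t -> F}) : 0 < indep_uniform R x.
Proof. by rewrite indep_uniformE exprn_gt0 // invr_gt0 card_field_gt0. Qed.

Lemma sum_indep_uniform : \sum_(x : {ffun 'I_t -> F}) indep_uniform R x = 1.
Proof.
under eq_bigr do rewrite indep_uniformE.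
rewrite sumr_const card_ffun card_ord -[LHS]mulr_natl natrX -exprMn divff ?expr1n //.
by rewrite gt_eqF // card_field_gt0.
Qed.

Lemma entropy_input (s : 'I_t) :
  entropy (@indep_uniform R F t) (fun x : {ffun 'I_t -> F} => x s) =
  log2 #|F|%:R.
Proof.
pose u a := pr (@indep_uniform R F t) [pred x : {ffun 'I_t -> F} | x s == a].
have q0 := card_field_gt0.
have uE a b : u a = u b.
  (* Translation by [d] preserves the law and carries the event [x s = b] to [x s = a]. *)
  pose d : {ffun 'I_t -> F} := [ffun i => if i == s then a - b else 0].
  rewrite /u /pr (reindex_inj (addIr d)) /=; apply: eq_big => x.
    rewrite /= !ffunE eqxx; apply/eqP/eqP => [xa|->]; last by rewrite addrC subrK.
    by rewrite -[LHS](addrK (a - b)) xa opprB addrC subrK.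
  by rewrite !indep_uniformE.
have u1 : \sum_a u a = 1.
  by rewrite -sum_indep_uniform [RHS](partition_big (fun x : {ffun 'I_t -> F} => x s) xpredT).
have ua a : u a = #|F|%:R^-1.
  have : \sum_(b : F) u a = 1 by rewrite -u1; apply: eq_bigr => b _; apply: uE.
  rewrite sumr_const -[LHS]mulr_natl => ua1.
  by apply: (mulfI (lt0r_neq0 q0)); rewrite ua1 divff // gt_eqF.
rewrite /entropy /=; under eq_bigr => a _ do rewrite -/(u a) ua.
rewrite sumr_const -[X in - X = _]mulr_natl mulrA divff ?gt_eqF // mul1r /log2.
by rewrite lnV ?posrE // mulNr opprK.
Qed.

End UniformInputs.

(** * Circuits *)

Section Shares.
Variables (R : realType) (F : finFieldType) (t n : nat) (C : circuit F t n).
Variable s : 'I_t.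
Hypothesis CP : computes_threshold_shares R C s.
Implicit Types (T : {set 'I_n}) (x : {ffun 'I_t -> F}).

Lemma shares_eqP T x x' :
  shares C T x = shares C T x' <->
  forall j, j \in T -> eval x (output C j) = eval x' (output C j).
Proof.
split=> [xx j jT|xx]; last by apply/ffunP => j; rewrite !ffunE xx // (valP j).
by have /ffunP/(_ (Sub j jT)) := xx; rewrite !ffunE.
Qed.

Lemma shares_secret T x x' :
  #|T| = t -> shares C T x = shares C T x' -> x s = x' s.
Proof.
move=> cT; have [/(_ T cT) H _] := CP.
by move=> /(cond_entropy_eq0 (@indep_uniform_gt0 R F t) H).
Qed.

Lemma shares_hiding T x a :
  #|T| = t.-1 -> exists x', shares C T x' = shares C T x /\ x' s = a.
Proof.
move=> cT; have [_ /(_ T cT) H] := CP.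
rewrite entropy_input in H.
exact: (cond_entropy_full (@indep_uniform_gt0 R F t) x a (@sum_indep_uniform R F t) H).
Qed.

(** Fixing all shares in [T] but one leaves the secret arbitrary, and the last
    share must then distinguish all [#|F|] secrets. *)
Lemma shares_update T x (i : {i | i \in T}) c : #|T| = t ->
  exists x', forall j, shares C T x' j = if j == i then c else shares C T x j.
Proof.
move=> cT; have cT' : #|T :\ val i| = t.-1.
  by rewrite -cT (cardsD1 (val i) T) (valP i).
have [f fP] := choice (fun a => shares_hiding x a cT').
have fj a j : j != i -> shares C T (f a) j = shares C T x j.
  move=> ji; have jT : val j \in T :\ val i by rewrite !inE (valP j) andbT (inj_eq val_inj).
  by have /shares_eqP/(_ _ jT) := (fP a).1; rewrite !ffunE.
have finj : injective (fun a => shares C T (f a) i).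
  move=> a b ab; rewrite -(fP a).2 -(fP b).2; apply: (shares_secret cT).
  by apply/ffunP => j; have [->//|ji] := eqVneq j i; rewrite !fj.
have [g _ gK] := injF_bij finj.
exists (f (g c)) => j; have [->|ji] := eqVneq j i; first exact: gK.
exact: fj.
Qed.

(** Updating one share at a time realizes every share vector, and a surjection between sets of equal
    size [#|F| ^ t] is injective. *)
Lemma shares_inj T : #|T| = t -> injective (shares C T).
Proof.
move=> cT.
have surj (y : {ffun {i : 'I_n | i \in T} -> F}) : exists x, shares C T x = y.
  suff [x xP] : exists x, forall j, j \in enum {: {i : 'I_n | i \in T}} ->
      shares C T x j = y j.
    by exists x; apply/ffunP => j; rewrite xP // mem_enum.
  elim: (enum _) => [|i l [x xP]]; first by exists [ffun=> 0%R].
  have [x' x'P] := shares_update x i (y i) cT; exists x' => j.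
  by rewrite inE x'P; case: eqVneq => [->//|_] /xP.
have [g gP] := choice surj.
have ginj : injective g by apply: (can_inj (g := shares C T)).
have [|h hK Kh] := inj_card_bij ginj.
  by rewrite !card_ffun card_sig card_ord /= cT.
have gK : cancel (shares C T) g.
  by move=> x; rewrite -[in RHS](Kh x) -[in LHS](Kh x) gP.
exact: can_inj gK.
Qed.

End Shares.

(** * Connectivity of the circuit and its layered network *)

Section Reach.
Variables (F : finFieldType) (t n : nat) (C : circuit F t n).
Implicit Types (A : {set 'I_t}) (H : {set vertex C}).

Definition avoid H : rel (vertex C) :=
  [rel u v | [&& wire u v, u \notin H & v \notin H]].

Definition reached H A v :=
  [exists i in A, (input C i \notin H) && connect (avoid H) (input C i) v].

(** Induction on the number of ancestors: the in-neighbours of an unreached vertex outside [H] lie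
    in [H] or are unreached. *)
Lemma eval_unreached H A (x x' : 'I_t -> F) v :
    (forall i, i \notin A -> x i = x' i) ->
    (forall u, u \in H -> eval x u = eval x' u) ->
  ~~ reached H A v -> eval x v = eval x' v.
Proof.
move=> xA xH; have [k] := ubnP #|[pred w | connect (@wire _ _ _ C) w v]|.
elim: k v => // k IH v vk vA.
have [/xH //|vH] := boolP (v \in H).
case: (pickP (fun i => input C i == v)) => [i /eqP iv|vP].
  rewrite -iv !eval_input xA //; apply: contra vA => iA.
  by apply/exists_inP; exists i => //; rewrite iv vH connect0.
have vN i : input C i != v by rewrite vP.
rewrite !eval_gate //; congr gate; apply/ffunP => -[u uv]; rewrite !ffunE /=.
have [/xH //|uH] := boolP (u \in H).
apply: IH; first by rewrite (leq_trans (anc_lt uv)).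
apply: contra vA => /exists_inP[i iA /andP[iH iu]].
apply/exists_inP; exists i => //; rewrite iH /=; apply: connect_trans iu (connect1 _).
by rewrite /avoid /= uv uH.
Qed.

(** If [t] outputs were unreachable from [A] in the complement of [H], the
    [#|H|] values on [H] would determine these outputs, hence the [#|A|] free
    inputs. *)
Lemma card_reached H A :
    (forall T : {set 'I_n}, #|T| = t -> injective (shares C T)) ->
    #|H| < #|A| ->
  n < t + #|[set j | reached H A (output C j)]|.
Proof.
move=> inj HA; rewrite ltnNge; apply/negP => le.
set B := [set j | _] in le.
have /card_geqP[l [ul sl lB]] : t <= #|~: B|.
  by have := cardsC B; rewrite card_ord; lia.
pose T := [set j in l].
have cT : #|T| = t by rewrite cardsE (card_uniqP ul).
pose ext (y : {ffun {i | i \in A} -> F}) : {ffun 'I_t -> F} :=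
  [ffun i => if insub i is Some j then y j else 0%R].
pose val_H y : {ffun {u | u \in H} -> F} := [ffun u => eval (ext y) (val u : vertex C)].
have val_inj : injective val_H.
  move=> y y' yy; have xx : ext y = ext y'.
    apply: (inj T cT); apply/ffunP => -[j jT]; rewrite !ffunE /=.
    apply: (@eval_unreached H A).
    - by move=> i iA; rewrite !ffunE insubN.
    - by move=> u uH; have /ffunP/(_ (Sub u uH)) := yy; rewrite !ffunE.
    - by move: jT; rewrite inE => /lB; rewrite !inE.
  apply/ffunP => i; have /ffunP/(_ (val i)) := xx.
  by rewrite !ffunE valK.
have := leq_card _ val_inj.
by rewrite !card_ffun !card_sig /= leq_exp2l ?card_finNzRing_gt1 // leqNgt HA.
Qed.

(** The loops pad all paths to the same length; only inputs and heads of wires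
    need one. *)
Definition layer : {set vertex C * vertex C} :=
  [set e | wire e.1 e.2] :|:
  [set (v, v) | v in [set input C i | i : 'I_t] :|:
                     [set e.2 | e in [set e | @wire _ _ _ C e.1 e.2]]].

Lemma card_layer : #|layer| <= 2 * wires C + t.
Proof.
apply: leq_trans (leq_card_setU _ _).1 _.
rewrite mul2n -addnn -addnA leq_add //.
apply: leq_trans (leq_imset_card _ _) _.
apply: leq_trans (leq_card_setU _ _).1 _; rewrite addnC leq_add //.
  exact: leq_imset_card.
by apply: leq_trans (leq_imset_card _ _) _; rewrite card_ord.
Qed.

Lemma conn_layer H k v p :
    size p <= k -> v \notin H -> (v, v) \in layer -> path (avoid H) v p ->
  conn (nseq k layer) H v (last v p).
Proof.
elim: k v p => [|k IH] v [|w p] //= pk vH vl; rewrite ?vH ?eqxx //=.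
  by move=> _; apply/existsP; exists v; rewrite vl; apply: (IH v [::]).
case/andP=> /and3P[vw _ wH] wp; apply/existsP; exists w; apply/andP; split.
  by rewrite !inE vw.
apply: IH => //; rewrite inE; apply/orP; right; apply/imsetP; exists w => //.
by rewrite inE; apply/orP; right; apply/imsetP; exists (v, w); rewrite ?inE.
Qed.

Lemma robust_layer K d :
    (forall T : {set 'I_n}, #|T| = t -> injective (shares C T)) ->
    depth C <= d -> n <= K * t -> n <= K * (n - t) ->
  robust K n 0 (nseq d layer) [set input C i | i : 'I_t]
    [set output C j | j : 'I_n].
Proof.
move=> inj Cd nt nnt; split; first by rewrite card_imset ?card_ord //; apply: input_inj.
move=> A H AI; rewrite addn0 => HA.
pose A' := input C @^-1: A.
have AA' : #|A| <= #|A'|.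
  rewrite -(card_imset (mem A') (@input_inj _ _ _ C)); apply/subset_leq_card/subsetP => v vA.
  by have /imsetP[i _ vi] := subsetP AI v vA; apply/imsetP; exists i; rewrite // inE -vi.
have := card_reached inj (leq_trans HA AA'); set B := [set j | _] => nB.
apply: leq_trans nnt _; rewrite leq_mul2l; apply/orP; right.
apply: leq_trans (_ : #|[set output C j | j in B]| <= _).
  by rewrite card_imset; [lia | apply: output_inj].
apply/subset_leq_card/subsetP => v /imsetP[j]; rewrite inE => /exists_inP[i].
rewrite inE => iA /andP[iH /connectP[p ip pl]] ->; rewrite inE imset_f ?andbT //.
apply/reachP; exists (input C i) => //; rewrite pl; apply: conn_layer => //.
  apply: leq_trans Cd; apply: leq_depth (esym pl).
  by apply: sub_path ip => u w /and3P[].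
rewrite inE; apply/orP; right; apply/imsetP; exists (input C i) => //.
by rewrite inE imset_f.
Qed.

(** A single input, with nothing deleted, reaches more than [n - t] outputs, and each of them other
    than the input itself is the head of a wire. This bound lets the loops at the inputs be charged
    to wires. *)
Lemma n_le_wires :
    (forall T : {set 'I_n}, #|T| = t -> injective (shares C T)) ->
  0 < t -> n <= t + wires C.
Proof.
move=> inj t0; have HA : #|set0 : {set vertex C}| < #|[set Ordinal t0]|.
  by rewrite cards0 cards1.
have := card_reached inj HA; set B := [set j | _] => nB.
suff : #|B| <= (wires C).+1 by lia.
apply: leq_trans (_ : #|[set output C j | j in B]| <= _).
  by rewrite card_imset //; apply: output_inj.
apply: leq_trans (_ : #|input C (Ordinal t0) |:
    [set e.2 | e in [set e | @wire _ _ _ C e.1 e.2]]| <= _); last first.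
  by rewrite cardsU1 -add1n leq_add ?leq_b1 // leq_imset_card.
apply/subset_leq_card/subsetP => v /imsetP[j]; rewrite inE => /exists_inP[i].
rewrite inE => /eqP -> /andP[_ /connectP[p ip pl]] ->; rewrite pl !inE.
case/lastP: p ip {pl} => [|p w]; first by rewrite eqxx.
rewrite rcons_path last_rcons => /andP[_ /and3P[pw _ _]]; apply/orP; right.
by apply/imsetP; exists (last (input C (Ordinal t0)) p, w); rewrite ?inE.
Qed.

End Reach.

(** * The lower bound on the number of wires *)

Local Open Scope ring_scope.

Theorem theorem3 (R : realType) (c : R) (d : nat) (c_gt0 : 0 < c)
    (c_lt1 : c < 1) (d_ge1 : (1 <= d)%N) :
  exists (kappa : R) (n0 : nat), 0 < kappa /\
    forall n t : nat, (n0 <= n)%N -> t%:R = c * n%:R ->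
    forall (F : finFieldType) (C : circuit F t n) (s : 'I_t),
      depth C = d ->
      computes_threshold_shares R C s ->
      kappa * (lambda d n)%:R * n%:R <= (wires C)%:R.
Proof.
(* Bounding both [1 / c] and [1 / (1 - c)] by [K0] makes [t] and [n - t] at least [n / K0]. *)
have [K0 K0c K0c'] : exists2 K0 : nat, 1 <= K0%:R * c & 1 <= K0%:R * (1 - c).
  pose K1 := Num.truncn c^-1; pose K2 := Num.truncn (1 - c)^-1.
  have c'0 : 0 < 1 - c by rewrite subr_gt0.
  exists (K1 + K2).+1.
    rewrite -ler_pdivrMr // div1r; apply: ltW; apply: lt_le_trans (truncnS_gt _) _.
    by rewrite ler_nat ltnS leq_addr.
  rewrite -ler_pdivrMr // div1r; apply: ltW; apply: lt_le_trans (truncnS_gt _) _.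
  by rewrite ler_nat ltnS leq_addl.
have [_ lb] := lambda_lower_bound d_ge1; have [K KP] := lb K0.
(* The network has [d] copies of a layer with at most [(2 + K0) * wires C] edges; the [+ 1] keeps
   [M] positive. *)
pose M := (K * d * (2 + K0) + 1)%N.
exists (M%:R^-1), K; split; first by rewrite invr_gt0 ltr0n /M addn1.
move=> n t Kn tn F C s Cd CP.
have inj := shares_inj CP.
have nat_le m : n%:R <= K0%:R * m%:R :> R -> (n <= K0 * m)%N by rewrite -natrM ler_nat.
have t_le_n : (t <= n)%N.
  by rewrite -(ler_nat R) tn ler_piMl // ltW.
have nt : (n <= K0 * t)%N.
  by apply: nat_le; rewrite tn mulrA ler_peMl.
have nnt : (n <= K0 * (n - t))%N.
  apply: nat_le; rewrite natrB // tn -[X in X - _]mul1r -mulrBl mulrA.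
  by rewrite ler_peMl.
have t0 : (0 < t)%N := leq_ltn_trans (leq0n s) (ltn_ord s).
have rob := robust_layer inj (eq_leq Cd) nt nnt.
have := KP _ _ _ _ n 0 n (size_nseq _ _) rob Kn; rewrite muln1 leqnn => /(_ isT).
have -> : edges (nseq d (layer C)) = (d * #|layer C|)%N.
  by rewrite /edges big_nseq iter_addn_0 mulnC.
move=> le.
have tw : (t <= K0 * wires C)%N.
  apply: leq_trans t_le_n _; apply: leq_trans nnt _; rewrite leq_mul2l.
  by have := n_le_wires inj t0; rewrite -leq_subLR => ->; rewrite orbT.
have {}le : (lambda d n * n <= M * wires C)%N.
  rewrite mulnC; apply: leq_trans le _; rewrite mulnA.
  apply: (@leq_trans (K * d * ((2 + K0) * wires C))); last by rewrite /M; lia.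
  rewrite leq_mul2l; apply/orP; right.
  by apply: leq_trans (card_layer C) _; lia.
rewrite -mulrA -natrM mulrC ler_pdivrMr; last by rewrite ltr0n /M addn1.
by rewrite -natrM ler_nat (mulnC (wires C)).
Qed.
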